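(* Let $(f_i)_{i=1}^\infty$ be a sequence in $\mathcal{H}$ which satisfies the lower frame condition, and assume that the set $\{h\in\mathcal{H}:(\langle h,f_i\rangle)_{i=1}^\infty\in\ell^2\}$ (the domain of its analysis operator) is dense in $\mathcal{H}$. Then there exists a Bessel sequence $(g_i)_{i=1}^\infty$ in $\mathcal{H}$ so that for $f\in\mathcal{H}$ one has $$f=\sum_{i=1}^\infty\langle f,g_i\rangle f_i\quad\text{if and only if}\quad\sum_{i=1}^\infty\langle f,g_i\rangle f_i\ \text{converges}.$$
   Context: $\mathcal{H}$ is an infinite-dimensional separable Hilbert space. Series convergence is norm convergence. A sequence $(f_i)_{i=1}^\infty$ in $\mathcal{H}$ satisfies the lower frame condition if there is $A>0$ with $A\|h\|^2\le\sum_{i=1}^\infty|\langle h,f_i\rangle|^2$ for all those $h\in\mathcal{H}$ for which $\sum_{i=1}^\infty|\langle h,f_i\rangle|^2<\infty$. A sequence $(g_i)_{i=1}^\infty$ in $\mathcal{H}$ is a Bessel sequence if there is $B>0$ with $\sum_{i=1}^\infty|\langle h,g_i\rangle|^2\le B\|h\|^2$ for all $h\in\mathcal{H}$. *)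

(* Defs.v *)
From HB Require Import structures.
From mathcomp Require Import all_boot all_order all_algebra.
From mathcomp Require Import complex.
From mathcomp Require Import all_classical all_reals all_analysis.

Set Implicit Arguments.
Unset Strict Implicit.
Unset Printing Implicit Defensive.

Import Order.TTheory GRing.Theory Num.Theory.
Import numFieldNormedType.Exports.

Local Open Scope classical_set_scope.
Local Open Scope ring_scope.

(* A Hilbert space may be real or complex; [scalar_field R k] is the field R
   or R[i], and [conj_of R k] its conjugation (the identity in the real case).
   On R[i] the order is partial: [0 < A] says that A is real and positive. *)
Variant field_kind := RealScalars | ComplexScalars.

Definition scalar_field (R : realType) (k : field_kind) : numFieldType :=
  match k with
  | RealScalars => R
  | ComplexScalars => R[i]
  end.

Definition conj_of (R : realType) (k : field_kind) :
    scalar_field R k -> scalar_field R k :=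
  match k with
  | RealScalars => idfun
  | ComplexScalars => @conjc R
  end.
Arguments conj_of : clear implicits.

Section Hilbert.
Variables (K : numFieldType) (theta : K -> K).

Definition separable_space (T : topologicalType) :=
  exists2 D : set T, countable D & dense D.

Definition finite_dimensional (V : lmodType K) :=
  exists (n : nat) (e : 'I_n -> V),
    forall v, exists c : 'I_n -> K, v = \sum_(i < n) c i *: e i.

(* [ip] is positive definite, linear in its first argument and
   [theta]-semilinear in its second one; completeness is part of [H]. *)
Definition is_hilbert (H : completeNormedModType K) (ip : {dot H for theta}) :=
  forall h : H, `|h| ^+ 2 = ip h h.

Variables (H : completeNormedModType K) (ip : {dot H for theta}).
Implicit Types f g : nat -> H.

Definition analysis_series f (h : H) : nat -> K :=
  series (fun i => `|ip h (f i)| ^+ 2).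

Definition analysis_domain f : set H := [set h | cvgn (analysis_series f h)].

Definition lower_frame_condition f :=
  exists2 A : K, 0 < A &
    forall h, analysis_domain f h ->
      A * `|h| ^+ 2 <= limn (analysis_series f h).

(* [limn] is meaningful only for convergent series, so the finiteness of the
   sum is stated separately. *)
Definition bessel_sequence g :=
  exists2 B : K, 0 < B &
    forall h, analysis_domain g h /\
      limn (analysis_series g h) <= B * `|h| ^+ 2.

Definition reconstruction_series f g (h : H) : nat -> H :=
  series (fun i => ip h (g i) *: f i).

End Hilbert.

(* Main.v *)
Require Import Defs.
From HB Require Import structures.
From mathcomp Require Import all_boot all_order all_algebra.
From mathcomp Require Import complex.
From mathcomp Require Import all_classical all_reals all_analysis.
From mathcomp Require Import ring lra.

Set Implicit Arguments.
Unset Strict Implicit.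
Unset Printing Implicit Defensive.

Import Order.TTheory GRing.Theory Num.Theory.
Import numFieldNormedType.Exports.

Local Open Scope classical_set_scope.
Local Open Scope ring_scope.

(** Let D be the domain of the analysis operator of f, and call the energy of
    h in D the sum Q(h) of |<h, f_i>|^2.  The lower frame condition says that
    Q is coercive, A |h|^2 <= Q(h), and the analysis operator is closed, so D
    is a Hilbert space for the form polarizing Q.  Riesz representation in
    that space gives, for every y in H, a vector G y of D with

      sum_i <G y, f_i> <f_i, h> = <y, h>   for all h in D.

    So G inverts the frame operator in the weak sense.  Concretely G y
    minimizes Q(h) - 2 Re <h, y> over D: a minimizing sequence is Cauchy by the
    parallelogram law and coercivity, its limit is a minimizer because Q is a
    supremum of continuous functions, and the first-order condition is the
    displayed equation ([dirichlet_minimizer], [weak_solution]).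

    Take g_i = G f_i.  The form is hermitian, so G is self-adjoint and
    <y, g_i> = <G y, f_i> ([weak_inverse_self_adjoint]).  The square sum of
    these coefficients is Q(G y) = Re <G y, y>, which coercivity bounds by
    |y|^2 / A; hence g is a Bessel sequence ([bessel_weak_inverse]).

    If the series of the vectors <y, g_i> f_i converges to z, pairing with h in
    D gives <z, h> = sum_i <G y, f_i> <f_i, h> = <y, h>, and z = y because D is
    dense ([reconstruction_limit]).

    The scalars are treated uniformly: everything is expressed through real
    parts, which determine a scalar once all its multiples are tested
    ([eq_re_test]). *)

(** * Real and complex scalars at once *)

Section Scalars.
Variables (R : realType) (k : field_kind).
Local Notation K := (scalar_field R k).

Definition re_part : K -> R :=
  match k return scalar_field R k -> R with
  | RealScalars => idfun
  | ComplexScalars => @complex.Re R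
  end.

Definition of_real : R -> K :=
  match k return R -> scalar_field R k with
  | RealScalars => idfun
  | ComplexScalars => fun r => (r +i* 0)%C
  end.

Lemma re_part_is_zmod_morphism : zmod_morphism re_part.
Proof. by rewrite /re_part; case: k => // -[a b] [c d]. Qed.

HB.instance Definition _ :=
  GRing.isZmodMorphism.Build K R re_part re_part_is_zmod_morphism.

Lemma of_real_is_zmod_morphism : zmod_morphism of_real.
Proof.
by rewrite /of_real; case: k => // a b; apply/eqP; rewrite eq_complex /= subr0 !eqxx.
Qed.

Lemma of_real_is_monoid_morphism : monoid_morphism of_real.
Proof.
rewrite /of_real; case: k => //; split=> // a b; apply/eqP.
by rewrite eq_complex /= !mul0r !mulr0 subr0 addr0 !eqxx.
Qed.

HB.instance Definition _ :=
  GRing.isZmodMorphism.Build R K of_real of_real_is_zmod_morphism.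
HB.instance Definition _ :=
  GRing.isMonoidMorphism.Build R K of_real of_real_is_monoid_morphism.

Lemma conj_is_zmod_morphism : zmod_morphism (conj_of R k).
Proof. by rewrite /conj_of; case: k => // x y; rewrite rmorphB. Qed.

Lemma conj_is_monoid_morphism : monoid_morphism (conj_of R k).
Proof.
by rewrite /conj_of; case: k => //; split=> [|x y]; rewrite ?rmorph1 ?rmorphM.
Qed.

HB.instance Definition _ :=
  GRing.isZmodMorphism.Build K K (conj_of R k) conj_is_zmod_morphism.
HB.instance Definition _ :=
  GRing.isMonoidMorphism.Build K K (conj_of R k) conj_is_monoid_morphism.

Lemma conj_of_realK : involutive (conj_of R k).
Proof. by rewrite /conj_of; case: k => // x; rewrite conjcK. Qed.

Lemma re_conj z : re_part (conj_of R k z) = re_part z.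
Proof. by move: z; rewrite /re_part /conj_of; case: k => // -[]. Qed.

Lemma conj_of_real r : conj_of R k (of_real r) = of_real r.
Proof. by rewrite /conj_of /of_real; case: k => //=; rewrite oppr0. Qed.

Lemma of_realK : cancel of_real re_part.
Proof. by rewrite /of_real /re_part; case: k. Qed.

Lemma reMl r z : re_part (of_real r * z) = r * re_part z.
Proof.
by move: z; rewrite /of_real /re_part; case: k => // -[a b]; rewrite /= mul0r subr0.
Qed.

Lemma ler_of_real r s : (of_real r <= of_real s) = (r <= s).
Proof. by rewrite /of_real; case: k => //; rewrite lecE /= eqxx. Qed.

Lemma ltr_of_real r s : (of_real r < of_real s) = (r < s).
Proof. by rewrite /of_real; case: k => //; rewrite ltcE /= eqxx. Qed.

Lemma re_partK z : 0 <= z -> of_real (re_part z) = z.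
Proof.
move: z; rewrite /of_real /re_part; case: k => // -[a b].
by rewrite lecE /= => /andP[/eqP ->].
Qed.

Lemma norm_of_real r : `|of_real r| = of_real `|r|.
Proof.
by rewrite /of_real; case: k => //; rewrite normc_def /= expr0n addr0 sqrtr_sqr.
Qed.

Lemma re_le_norm z : re_part z <= re_part `|z|.
Proof.
move: z; rewrite /re_part; case: k => [|z]; first exact: ler_norm.
by have := normc_ge_Re z; rewrite lecE => /andP[_]; apply/le_trans/ler_norm.
Qed.

Lemma norm_conj z : `|conj_of R k z| = `|z|.
Proof. by move: z; rewrite /conj_of; case: k => // z; rewrite normcJ. Qed.

Lemma mul_conj z : conj_of R k z * z = `|z| ^+ 2.
Proof.
move: z; rewrite /conj_of; case: k => z; last by rewrite mulrC sqr_normc.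
by rewrite real_normK ?num_real// expr2.
Qed.

End Scalars.
Arguments re_part {R k}.
Arguments of_real {R k}.

(** * Norms with real values *)

Section RealNorm.
Variables (R : realType) (k : field_kind).
Local Notation K := (scalar_field R k).

(** Norms are real elements of [K], whose order is partial in the complex case;
    with values in [R] they can be compared, bounded below and minimized. *)
Definition real_norm (V : normedZmodType K) (x : V) : R := re_part `|x|.

Lemma real_normE (V : normedZmodType K) (x : V) : of_real (real_norm x) = `|x|.
Proof. exact: re_partK. Qed.

Lemma real_norm_ge0 (V : normedZmodType K) (x : V) : 0 <= real_norm x.
Proof. by rewrite -(ler_of_real k) rmorph0 real_normE. Qed.

Lemma real_norm_eq0 (V : normedZmodType K) (x : V) : real_norm x = 0 -> x = 0.
Proof. by move=> x0; apply/normr0_eq0; rewrite -real_normE x0 rmorph0. Qed.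

Lemma real_normM (x y : K) : real_norm (x * y) = real_norm x * real_norm y.
Proof. by rewrite /real_norm normrM -!real_normE -rmorphM !of_realK. Qed.

Lemma real_norm_of_real (r : R) : real_norm (of_real r : K) = `|r|.
Proof. by rewrite /real_norm norm_of_real of_realK. Qed.

Lemma real_norm_sqr (z : K) : real_norm z ^+ 2 = re_part (conj_of R k z * z).
Proof. by rewrite mul_conj -real_normE -rmorphXn/= of_realK. Qed.

Lemma re_le_real_norm (z : K) : `|re_part z| <= real_norm z.
Proof.
rewrite ler_norml re_le_norm andbT lerNl -raddfN.
by apply: le_trans (re_le_norm _) _; rewrite normrN.
Qed.

(** Testing with [t] the conjugate of [z - w] yields [`|z - w| ^+ 2].  This
    reduces identities between scalars to identities between real parts. *)
Lemma eq_re_test (z w : K) :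
  (forall t, re_part (t * z) = re_part (t * w)) -> z = w.
Proof.
move=> zw; apply/subr0_eq/real_norm_eq0/eqP; rewrite -sqrf_eq0 real_norm_sqr.
by rewrite mulrBr raddfB/= zw subrr.
Qed.

Lemma cvgn_real_norm (V : pseudoMetricNormedZmodType K) (x : nat -> V) (l : V) :
  x @ \oo --> l <-> (forall e : R, 0 < e -> \forall n \near \oo, real_norm (l - x n) < e).
Proof.
split=> [/cvgrPdist_lt xl e e0|xl].
  have := xl (of_real e); rewrite -[X in X < _](rmorph0 of_real) ltr_of_real => /(_ e0).
  by apply: filterS => n; rewrite -real_normE ltr_of_real.
apply/cvgrPdist_lt => e e0.
have ee : of_real (re_part e) = e by apply/re_partK/ltW.
have := xl (re_part e); rewrite -(ltr_of_real k) rmorph0 ee => /(_ e0).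
by apply: filterS => n; rewrite -(ltr_of_real k) real_normE ee.
Qed.

Lemma cvgn_of_real (r : nat -> R) (l : R) :
  r @ \oo --> l -> (fun n => of_real (r n) : K) @ \oo --> (of_real l : K).
Proof.
move=> /cvgrPdist_lt rl; apply/cvgn_real_norm => e /rl.
by apply: filterS => n; rewrite -rmorphB real_norm_of_real.
Qed.

Lemma cvgn_re_part (z : nat -> K) (l : K) :
  z @ \oo --> l -> re_part \o z @ \oo --> re_part l.
Proof.
move=> /cvgn_real_norm zl; apply/cvgrPdist_lt => e /zl.
by apply: filterS => n; apply: le_lt_trans; rewrite -raddfB re_le_real_norm.
Qed.

End RealNorm.

(** * The real inner product *)

Section RealForm.
Variables (R : realType) (k : field_kind).
Local Notation K := (scalar_field R k).
Variables (H : completeNormedModType K) (ip : {dot H for conj_of R k}).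
Hypothesis hilbertH : is_hilbert ip.

Definition re_ip (x y : H) : R := re_part (ip x y).

Lemma ipC x y : ip x y = conj_of R k (ip y x).
Proof. by rewrite hermC mul1r. Qed.

Lemma re_ipC x y : re_ip x y = re_ip y x.
Proof. by rewrite /re_ip ipC re_conj. Qed.

Lemma re_ipDl x y z : re_ip (x + y) z = re_ip x z + re_ip y z.
Proof. by rewrite /re_ip linearDl raddfD. Qed.

Lemma re_ipBl x y z : re_ip (x - y) z = re_ip x z - re_ip y z.
Proof. by rewrite /re_ip linearBl raddfB. Qed.

Lemma re_ipBr x y z : re_ip z (x - y) = re_ip z x - re_ip z y.
Proof. by rewrite ![re_ip z _]re_ipC re_ipBl. Qed.

Lemma ipZl t x y : ip (t *: x) y = t * ip x y.
Proof. exact: linearZl_LR. Qed.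

Lemma re_ipZl r x y : re_ip (of_real r *: x) y = r * re_ip x y.
Proof. by rewrite /re_ip ipZl reMl. Qed.

Lemma re_ip_self x : re_ip x x = real_norm x ^+ 2.
Proof.
by rewrite /re_ip -hilbertH -(@real_normE _ _ H x) -rmorphXn/= of_realK.
Qed.

Lemma re_ip_le x y : re_ip x y <= real_norm x * real_norm y.
Proof.
have [x0|x0] := eqVneq (real_norm x) 0.
  by rewrite x0 mul0r (real_norm_eq0 x0) /re_ip linear0l raddf0.
have [y0|y0] := eqVneq (real_norm y) 0.
  by rewrite y0 mulr0 re_ipC (real_norm_eq0 y0) /re_ip linear0l raddf0.
have xy0 : 0 < real_norm x * real_norm y.
  by rewrite mulr_gt0// lt_neqAle eq_sym ?x0 ?y0 real_norm_ge0.
(* Both vectors in this difference have length [real_norm x * real_norm y]. *)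
have := sqr_ge0 (real_norm (of_real (real_norm y) *: x - of_real (real_norm x) *: y)).
rewrite -re_ip_self !re_ipBl !re_ipBr !re_ipZl ![re_ip _ (_ *: _)]re_ipC !re_ipZl.
rewrite !re_ip_self [re_ip y x]re_ipC => h.
rewrite -(ler_pM2l xy0); lra.
Qed.

(** Cauchy-Schwarz for the scalar-valued product follows from its real version:
    multiplying [x] by the conjugate of [ip x y] rotates the product onto the
    nonnegative real axis. *)
Lemma real_norm_ip_le x y : real_norm (ip x y) <= real_norm x * real_norm y.
Proof.
have [->|z0] := eqVneq (ip x y) 0.
  by rewrite /real_norm normr0 raddf0 mulr_ge0 ?real_norm_ge0.
have zgt0 : 0 < real_norm (ip x y).
  rewrite lt_neqAle real_norm_ge0 andbT eq_sym; apply: contra z0 => /eqP z0.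
  by apply/eqP/real_norm_eq0.
rewrite -(ler_pM2l zgt0) -expr2 real_norm_sqr -ipZl.
apply: le_trans (re_ip_le _ _) _; rewrite mulrA ler_wpM2r ?real_norm_ge0//.
rewrite [X in X <= _]/real_norm normrZ norm_conj -!real_normE -rmorphM.
by rewrite of_realK.
Qed.

Lemma cvgn_ipl (x : nat -> H) (l y : H) :
  x @ \oo --> l -> (fun n => ip (x n) y) @ \oo --> ip l y.
Proof.
move=> /cvgn_real_norm xl; apply/cvgn_real_norm => e e0.
(* Adding 1 keeps the divisor positive when [y = 0]. *)
have y1 : 0 < real_norm y + 1 by rewrite ltr_wpDl ?real_norm_ge0.
apply: filterS (xl _ (divr_gt0 e0 y1)) => n; rewrite ltr_pdivlMr// => xn.
rewrite -linearBl; apply: le_lt_trans (real_norm_ip_le _ _) _.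
apply: le_lt_trans xn; rewrite ler_wpM2l ?real_norm_ge0// lerDl//.
Qed.

(** Any point of [D] in the ball of radius [`|w|] around [w] makes an acute
    angle with [w]. *)
Lemma dense_orthogonal (D : set H) (w : H) :
  dense D -> (forall h, D h -> re_ip w h = 0) -> w = 0.
Proof.
move=> dD wD; apply/eqP/negPn/negP => w0.
have nw : 0 < `|w| by rewrite normr_gt0.
have [|h [wh Dh]] := dD (ball w `|w|) _ (ball_open _ _).
  by exists w; exact: ballxx.
have whn : real_norm (w - h) < real_norm w.
  by rewrite -(ltr_of_real k) !real_normE; move: wh; rewrite -ball_normE.
have := re_ip_le w (w - h); rewrite re_ipBr re_ip_self wD// subr0 expr2.
have w1 : 0 < real_norm w by apply: le_lt_trans whn; rewrite real_norm_ge0.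
by rewrite ler_pM2l// leNgt whn.
Qed.

End RealForm.

(** * The energy of a vector along a sequence *)

Section Energy.
Variables (R : realType) (k : field_kind).
Local Notation K := (scalar_field R k).
Variables (H : completeNormedModType K) (ip : {dot H for conj_of R k}).
Hypothesis hilbertH : is_hilbert ip.
Variable f : nat -> H.

Definition partial_energy (n : nat) (h : H) : R :=
  \sum_(0 <= i < n) real_norm (ip h (f i)) ^+ 2.

(** The real part of the form polarizing [partial_energy]; the imaginary part
    is recovered by rescaling one argument. *)
Definition partial_form (n : nat) (u h : H) : R :=
  \sum_(0 <= i < n) re_part (conj_of R k (ip h (f i)) * ip u (f i)).

Definition finite_energy (h : H) := cvgn (partial_energy ^~ h).

Definition energy (h : H) : R := limn (partial_energy ^~ h).

Lemma partial_energy_ge0 n h : 0 <= partial_energy n h.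
Proof. by apply: sumr_ge0 => i _; rewrite sqr_ge0. Qed.

Lemma partial_energy_nd h : {homo partial_energy ^~ h : n m / (n <= m)%N >-> n <= m}.
Proof. by apply: nondecreasing_series => i _ _; rewrite sqr_ge0. Qed.

Lemma analysis_series_of_real h :
  analysis_series ip f h = (fun n => of_real (partial_energy n h)).
Proof.
apply/funext => n; rewrite /analysis_series /series /partial_energy rmorph_sum /=.
by apply: eq_bigr => i _; rewrite rmorphXn/= real_normE.
Qed.

Lemma finite_energy_cvg h : finite_energy h ->
  analysis_series ip f h @ \oo --> (of_real (energy h) : K).
Proof. by move=> fin_h; rewrite analysis_series_of_real; apply: cvgn_of_real. Qed.

(** The partial sums are real scalars, so a limit among the scalars has the
    limit of the real partial sums as its real part. *)
Lemma analysis_domainP h : analysis_domain ip f h <-> finite_energy h.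
Proof.
split=> [/cvg_ex[l]|/finite_energy_cvg /cvgP //].
rewrite analysis_series_of_real => /cvgn_re_part hl; apply/cvg_ex; exists (re_part l).
suff <- : re_part \o (fun n => of_real (partial_energy n h) : K) =
    partial_energy ^~ h by [].
by apply/funext => n; rewrite /= of_realK.
Qed.

Lemma bounded_finite_energy h M :
  (forall n, partial_energy n h <= M) -> finite_energy h.
Proof.
move=> hM; apply: nondecreasing_is_cvgn; first exact: partial_energy_nd.
by exists M => _ [n _ <-].
Qed.

Lemma partial_energyZ n t h :
  partial_energy n (t *: h) = real_norm t ^+ 2 * partial_energy n h.
Proof.
rewrite /partial_energy mulr_sumr; apply: eq_bigr => i _.
by rewrite ipZl real_normM exprMn.
Qed.

Lemma partial_energyD n u h :
  partial_energy n (u + h) =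
    partial_energy n u + partial_form n u h *+ 2 + partial_energy n h.
Proof.
rewrite /partial_energy /partial_form -sumrMnl -!big_split /=.
apply: eq_bigr => i _; set z := ip u _; set w := ip h _.
rewrite linearDl -/z -/w !real_norm_sqr rmorphD mulrDl !mulrDr !raddfD /=.
have <- : re_part (conj_of R k z * w) = re_part (conj_of R k w * z).
  by rewrite -re_conj rmorphM/= conj_of_realK mulrC.
by rewrite mulr2n !addrA.
Qed.

Lemma partial_form_self n u : partial_form n u u = partial_energy n u.
Proof. by apply: eq_bigr => i _; rewrite real_norm_sqr. Qed.

Lemma partial_formZr n u s h :
  partial_form n u (of_real s *: h) = s * partial_form n u h.
Proof.
rewrite /partial_form mulr_sumr; apply: eq_bigr => i _.
by rewrite ipZl rmorphM/= conj_of_real -mulrA reMl.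
Qed.

Lemma partial_energy_parallelogram n u h :
  partial_energy n (u + h) + partial_energy n (u - h) =
    (partial_energy n u + partial_energy n h) *+ 2.
Proof.
have -> : - h = of_real (-1) *: h by rewrite rmorphN1 scaleN1r.
rewrite !partial_energyD partial_formZr partial_energyZ real_norm_of_real.
by rewrite normrN1 expr1n mul1r; ring.
Qed.

Lemma finite_energyZ t h : finite_energy h -> finite_energy (t *: h).
Proof.
move=> h_fin; apply: (@bounded_finite_energy _ (real_norm t ^+ 2 * energy h)) => n.
rewrite partial_energyZ ler_wpM2l ?sqr_ge0//.
by apply: nondecreasing_cvgn_le => //; exact: partial_energy_nd.
Qed.

Lemma energyZ t h : finite_energy h -> energy (t *: h) = real_norm t ^+ 2 * energy h.
Proof.
move=> h_fin; apply: cvg_lim => //.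
under eq_fun do rewrite partial_energyZ.
by apply: cvgM => //; exact: cvg_cst.
Qed.

Lemma finite_energyD u h : finite_energy u -> finite_energy h -> finite_energy (u + h).
Proof.
move=> u_fin h_fin.
apply: (@bounded_finite_energy _ ((energy u + energy h) *+ 2)) => n.
apply: (@le_trans _ _ ((partial_energy n u + partial_energy n h) *+ 2)).
  by rewrite -partial_energy_parallelogram lerDl partial_energy_ge0.
by rewrite lerMn2r lerD ?orbT//; apply: nondecreasing_cvgn_le => //;
  exact: partial_energy_nd.
Qed.

Lemma finite_energyB u h : finite_energy u -> finite_energy h -> finite_energy (u - h).
Proof.
by move=> u_fin h_fin; rewrite -scaleN1r; apply/finite_energyD/finite_energyZ.
Qed.

Lemma energy_parallelogram u h : finite_energy u -> finite_energy h ->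
  energy (u + h) + energy (u - h) = (energy u + energy h) *+ 2.
Proof.
move=> u_fin h_fin.
pose s n := partial_energy n (u + h) + partial_energy n (u - h).
have sl : s @ \oo --> energy (u + h) + energy (u - h).
  by apply: cvgD; [exact: finite_energyD|exact: finite_energyB].
have sr : s @ \oo --> (energy u + energy h) *+ 2.
  have -> : s = (fun n => (partial_energy n u + partial_energy n h) *+ 2).
    by apply/funext => n; exact: partial_energy_parallelogram.
  rewrite mulr2n; under eq_fun do rewrite mulr2n.
  by apply: cvgD; exact: cvgD.
exact: cvg_unique sl sr.
Qed.

Lemma partial_energy_cvg n (u : nat -> H) (l : H) : u @ \oo --> l ->
  (fun m => partial_energy n (u m)) @ \oo --> partial_energy n l.
Proof.
move=> ul; elim: n => [|n IH].
  under eq_fun do rewrite /partial_energy big_nil.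
  by rewrite /partial_energy big_nil; exact: cvg_cst.
rewrite /partial_energy; under eq_fun do rewrite big_nat_recr//=.
rewrite big_nat_recr//=; apply: cvgD => //.
have nl : (fun m => real_norm (ip (u m) (f n))) @ \oo --> real_norm (ip l (f n)).
  apply: cvgn_re_part; apply: cvg_norm; exact: cvgn_ipl.
by under eq_fun do rewrite expr2; rewrite expr2; exact: cvgM.
Qed.

End Energy.

(** * Minimizing the energy *)

(** The first-order condition at a minimum: a linear perturbation that stays
    above a parabola [- s ^+ 2 * q] with vertex at the origin has slope zero. *)
Lemma slope_eq0 (R : realFieldType) (c q : R) :
  (forall s, 0 <= s * c + s ^+ 2 * q) -> c = 0.
Proof.
move=> cq; apply/eqP/negPn/negP => c0.
have q1 : 0 < `|q| + 1 by rewrite ltr_wpDl.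
(* This step works for either sign of [q]: [`|q| + 1] is positive and exceeds [q]. *)
have := cq (- c / (`|q| + 1)).
set t := c / (`|q| + 1); have -> : - c / (`|q| + 1) = - t by rewrite mulNr.
have ct : c = t * (`|q| + 1) by rewrite divfK// gt_eqF.
have t0 : 0 < t ^+ 2.
  by rewrite exprn_even_gt0//= mulf_neq0// invr_neq0// gt_eqF.
rewrite [X in - t * X]ct sqrrN => h.
have := ler_norm q => qn.
have : t ^+ 2 * (`|q| + 1 - q) <= 0 by lra.
by rewrite pmulr_rle0// => ?; lra.
Qed.

Section Minimization.
Variables (R : realType) (k : field_kind).
Local Notation K := (scalar_field R k).
Variables (H : completeNormedModType K) (ip : {dot H for conj_of R k}).
Hypothesis hilbertH : is_hilbert ip.
Variables (f : nat -> H) (a : R).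
Hypothesis a_gt0 : 0 < a.
Hypothesis coercive :
  forall h, finite_energy ip f h -> a * real_norm h ^+ 2 <= energy ip f h.

(** The functional of the Dirichlet principle: where the frame operator
    [h |-> \sum_i <h, f i> f i] makes sense, its critical point is the
    preimage of [y]. *)
Definition dirichlet (y h : H) : R := energy ip f h - re_ip ip h y *+ 2.

Lemma dirichlet_ge y h : finite_energy ip f h ->
  - (real_norm y ^+ 2 / a) <= dirichlet y h.
Proof.
move=> /coercive ch; rewrite /dirichlet.
have := re_ip_le hilbertH h y.
have := sqr_ge0 (a * real_norm h - real_norm y).
set x := real_norm h in ch *; set b := real_norm y => sq cs.
(* Completing the square in [x]. *)
apply: (@le_trans _ _ (a * x ^+ 2 - x * b *+ 2)); last by lra.
rewrite -(ler_pM2l a_gt0) mulrN mulrCA divff ?gt_eqF// mulr1.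
by move: sq; rewrite -subr_ge0 => sq; rewrite -subr_ge0; lra.
Qed.

(** Uniform convexity: by the parallelogram law two nearly minimal points have
    a midpoint that would beat the minimum if they were far apart in energy,
    and coercivity turns closeness in energy into closeness in norm. *)
Lemma minimizing_close y m e u v :
  (forall h, finite_energy ip f h -> m <= dirichlet y h) ->
  finite_energy ip f u -> finite_energy ip f v ->
  dirichlet y u <= m + e -> dirichlet y v <= m + e ->
  a * real_norm (u - v) ^+ 2 <= e *+ 4.
Proof.
move=> min_m u_fin v_fin ue ve.
apply: le_trans (coercive (finite_energyB u_fin v_fin)) _.
have uv_fin := finite_energyD u_fin v_fin.
have := energy_parallelogram u_fin v_fin.
have := min_m (of_real 2^-1 *: (u + v)) (finite_energyZ uv_fin).
rewrite /dirichlet energyZ// real_norm_of_real re_ipZl re_ipDl.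
rewrite ger0_norm ?invr_ge0// expr2.
by move: ue ve; rewrite /dirichlet; lra.
Qed.

Lemma minimizing_cvg y m (u : nat -> H) :
  (forall h, finite_energy ip f h -> m <= dirichlet y h) ->
  (forall n, finite_energy ip f (u n)) ->
  (forall n, dirichlet y (u n) <= m + n.+1%:R^-1) -> cvgn u.
Proof.
move=> min_m u_fin um; apply/cauchy_cvgP/cauchy_exP => e e0.
have ee : of_real (re_part e) = e :> K by apply/re_partK/ltW.
have re0 : 0 < re_part e by rewrite -(ltr_of_real k) rmorph0 ee.
have c0 : 0 < a * re_part e ^+ 2 / 4 by rewrite divr_gt0// mulr_gt0// exprn_gt0.
have /cvgrPdist_lt/(_ _ c0)[N _ HN] := @cvg_harmonic R.
exists (u N), N => //= n Nn.
rewrite -ball_normE /= -(@real_normE _ _ H) -ee ltr_of_real.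
rewrite -(ltr_pXn2r (ltn0Sn 1)) ?nnegrE ?real_norm_ge0 ?ltW//.
rewrite -(ltr_pM2l a_gt0).
have un : dirichlet y (u n) <= m + N.+1%:R^-1.
  by apply: le_trans (um n) _; rewrite lerD2l lef_pV2 ?posrE// ler_nat.
apply: le_lt_trans (minimizing_close min_m (u_fin N) (u_fin n) (um N) un) _.
have := HN N (leqnn N); rewrite /= /harmonic sub0r normrN ger0_norm ?invr_ge0//.
by rewrite ltr_pdivlMr// mulr_natr.
Qed.

(** The limit of a minimizing sequence is a minimizer because every partial
    energy is norm continuous: the full energy, their supremum, is lower
    semicontinuous.  The same bound shows that the limit has finite energy, which
    is the closedness of the analysis operator. *)
Lemma dirichlet_minimizer y :
  exists2 u, finite_energy ip f u &
    forall h, finite_energy ip f h -> dirichlet y u <= dirichlet y h.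
Proof.
pose E := dirichlet y @` finite_energy ip f.
have fin0 : finite_energy ip f 0.
  apply: (@bounded_finite_energy _ _ _ _ _ _ 0) => n.
  by rewrite -(scale0r 0) partial_energyZ /real_norm normr0 raddf0 expr0n mul0r.
have lbE : lbound E (- (real_norm y ^+ 2 / a)).
  by move=> _ [h h_fin <-]; exact: dirichlet_ge.
have infE : has_inf E.
  by split; [exists (dirichlet y 0), 0|exists (- (real_norm y ^+ 2 / a))].
have min_m h : finite_energy ip f h -> inf E <= dirichlet y h.
  by move=> h_fin; apply: ge_inf; [exact: infE.2|exists h].
have /choice[u uP] n : exists u, finite_energy ip f u /\
    dirichlet y u <= inf E + n.+1%:R^-1.
  have [|_ [u u_fin <-] /ltW ue] := @inf_adherent _ E n.+1%:R^-1 _ infE.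
    by rewrite invr_gt0.
  by exists u.
have /cvg_ex[l ul] := minimizing_cvg min_m (fun n => (uP n).1) (fun n => (uP n).2).
have l_le n : partial_energy ip f n l - re_ip ip l y *+ 2 <= inf E.
  have lhs : (fun p => partial_energy ip f n (u p) - re_ip ip (u p) y *+ 2) @ \oo -->
      partial_energy ip f n l - re_ip ip l y *+ 2.
    apply: cvgB; first exact: partial_energy_cvg.
    have ipl := cvgn_re_part (cvgn_ipl hilbertH (y := y) ul).
    by rewrite mulr2n; under eq_fun do rewrite mulr2n; exact: cvgD.
  have rhs : (fun p => inf E + p.+1%:R^-1) @ \oo --> inf E.
    by rewrite -[X in _ --> X]addr0; apply: cvgD; [exact: cvg_cst|exact: cvg_harmonic].
  apply: ler_cvg_to lhs rhs _; apply: nearW => p /=.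
  apply: le_trans (uP p).2; rewrite lerB//.
  by apply: nondecreasing_cvgn_le (uP p).1 n; exact: partial_energy_nd.
have l_fin : finite_energy ip f l.
  apply: (@bounded_finite_energy _ _ _ _ _ _ (inf E + re_ip ip l y *+ 2)) => n.
  by rewrite -lerBlDr.
exists l => // h /min_m; apply: le_trans; rewrite /dirichlet lerBlDr.
by apply: limr_le => //; apply: nearW => n; rewrite -lerBlDr.
Qed.

(** The weak form of inverting the frame operator, which need not be defined on
    all of [H]: [u] plays the role of its inverse applied to [y].  The partial
    forms converge by polarization; the limit is identified by the first-order
    condition of the minimizer along each line [u + s h]. *)
Lemma weak_solution y :
  exists2 u, finite_energy ip f u &
    forall h, finite_energy ip f h ->
      (fun n => partial_form ip f n u h) @ \oo --> re_ip ip h y.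
Proof.
have [u u_fin u_min] := dirichlet_minimizer y; exists u => // h h_fin.
have form_cvg g : finite_energy ip f g ->
    (fun n => partial_form ip f n u g) @ \oo -->
      (energy ip f (u + g) - energy ip f u - energy ip f g) / 2.
  move=> g_fin.
  have -> : (fun n => partial_form ip f n u g) =
      (fun n => (partial_energy ip f n (u + g) - partial_energy ip f n u -
        partial_energy ip f n g) / 2).
    by apply/funext => n; rewrite partial_energyD; lra.
  apply: cvgM; last exact: cvg_cst.
  by do 2 ?apply: cvgB => //; exact: finite_energyD.
suff <- : (energy ip f (u + h) - energy ip f u - energy ip f h) / 2 = re_ip ip h y.
  exact: form_cvg.
apply/subr0_eq; apply: (@slope_eq0 _ _ (energy ip f h / 2)) => s.
have sh_fin := finite_energyZ (t := of_real s) h_fin.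
have form_sh := form_cvg _ sh_fin.
have form_sh' : (fun n => partial_form ip f n u (of_real s *: h)) @ \oo -->
    s * ((energy ip f (u + h) - energy ip f u - energy ip f h) / 2).
  under eq_fun do rewrite partial_formZr.
  by apply: cvgM; [exact: cvg_cst|exact: form_cvg].
have := cvg_lim (@Rhausdorff R) form_sh.
rewrite (cvg_lim (@Rhausdorff R) form_sh').
have := u_min _ (finite_energyD u_fin sh_fin).
rewrite /dirichlet energyZ// re_ipDl re_ipZl real_norm_of_real.
by rewrite real_normK ?num_real// => ? /(_ _) ?; lra.
Qed.

End Minimization.

(** * The dual sequence *)

Section Reconstruction.
Variables (R : realType) (k : field_kind).
Local Notation K := (scalar_field R k).
Variables (H : completeNormedModType K) (ip : {dot H for conj_of R k}).
Hypothesis hilbertH : is_hilbert ip.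
Variables (f : nat -> H) (a : R).
Hypothesis a_gt0 : 0 < a.
Hypothesis coercive :
  forall h, finite_energy ip f h -> a * real_norm h ^+ 2 <= energy ip f h.

(** [G] inverts the frame operator of [f], read as a form on the vectors of
    finite energy. *)
Definition weak_inverse (G : H -> H) := forall y, finite_energy ip f (G y) /\
  forall h, finite_energy ip f h ->
    (fun n => partial_form ip f n (G y) h) @ \oo --> re_ip ip h y.

Lemma partial_formC n u h : partial_form ip f n u h = partial_form ip f n h u.
Proof.
apply: eq_bigr => i _.
by rewrite -re_conj rmorphM/= conj_of_realK mulrC.
Qed.

Lemma partial_formZl n t u h :
  partial_form ip f n (t *: u) h = partial_form ip f n u (conj_of R k t *: h).
Proof.
apply: eq_bigr => i _; rewrite !ipZl rmorphM/= conj_of_realK.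
by rewrite mulrCA mulrA.
Qed.

Variable G : H -> H.
Hypothesis GP : weak_inverse G.

(** Both sides, tested against [t], are limits of the same partial forms of
    [G x] and [G y]. *)
Lemma weak_inverse_self_adjoint x y : ip (G x) y = ip x (G y).
Proof.
apply: eq_re_test => t.
have lim1 := (GP y).2 _ (finite_energyZ (t := t) (GP x).1).
have lim2 := (GP x).2 _ (finite_energyZ (t := conj_of R k t) (GP y).1).
move: lim1; under eq_fun do rewrite partial_formC partial_formZl.
move=> lim1; have := cvg_lim (@Rhausdorff R) lim1.
rewrite (cvg_lim (@Rhausdorff R) lim2) => /(_ _).
rewrite /re_ip !ipZl => <-.
by rewrite -re_conj rmorphM/= conj_of_realK -ipC.
Qed.

Lemma weak_inverse_energy y : energy ip f (G y) = re_ip ip (G y) y.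
Proof.
apply: cvg_lim; first exact: Rhausdorff.
by under eq_fun do rewrite -partial_form_self; exact: (GP y).2 _ (GP y).1.
Qed.

(** With [x] and [b] the norms of [G y] and [y], coercivity gives
    [a x^2 <= x b], so [x <= b / a], while the energy is at most [x b]. *)
Lemma weak_inverse_energy_le y : energy ip f (G y) <= a^-1 * real_norm y ^+ 2.
Proof.
have := coercive (GP y).1; rewrite weak_inverse_energy.
have := re_ip_le hilbertH (G y) y.
set x := real_norm (G y); set b := real_norm y => xb ax.
rewrite -(ler_pM2l a_gt0) mulrA divff ?gt_eqF// mul1r.
apply: (@le_trans _ _ (a * (x * b))); first by rewrite ler_pM2l.
have [->|x0] := eqVneq x 0; first by rewrite mul0r mulr0 sqr_ge0.
have x_gt0 : 0 < x by rewrite lt_neqAle eq_sym x0 real_norm_ge0.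
rewrite mulrA expr2 ler_wpM2r ?real_norm_ge0//.
by rewrite -(ler_pM2l x_gt0); apply: le_trans xb; apply: le_trans ax;
  rewrite expr2 mulrCA.
Qed.

(** Self-adjointness turns the coefficients of [y] along [G \o f] into those
    of [G y] along [f], whose square sum is the energy of [G y]. *)
Lemma analysis_series_weak_inverse y :
  analysis_series ip (G \o f) y = analysis_series ip f (G y).
Proof.
apply/funext => n; apply: eq_bigr => i _.
by rewrite weak_inverse_self_adjoint.
Qed.

Lemma bessel_weak_inverse : bessel_sequence ip (G \o f).
Proof.
exists (of_real a^-1 : K); first by rewrite -(rmorph0 of_real) ltr_of_real invr_gt0.
move=> y; rewrite /analysis_domain /= analysis_series_weak_inverse.
have Gy := finite_energy_cvg (GP y).1; split; first exact: cvgP Gy.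
rewrite (cvg_lim _ Gy)//.
rewrite -(@real_normE _ _ H) -rmorphXn/= -rmorphM ler_of_real.
exact: weak_inverse_energy_le.
Qed.

Lemma re_ip_reconstruction y h n :
  re_ip ip (reconstruction_series ip f (G \o f) y n) h = partial_form ip f n (G y) h.
Proof.
rewrite /re_ip /reconstruction_series /series /= linear_sumlz raddf_sum.
apply: eq_bigr => i _.
by rewrite /= ipZl -weak_inverse_self_adjoint [ip (f i) h]ipC mulrC.
Qed.

(** Paired with a vector [h] of finite energy, the partial sums become the
    partial forms of [G y] and [h], which tend to the pairing of [y] with [h];
    norm convergence to [z] gives the same limit for [z]. *)
Lemma reconstruction_limit y z : dense (finite_energy ip f) ->
  reconstruction_series ip f (G \o f) y @ \oo --> z -> z = y.
Proof.
move=> dD Sz; apply/subr0_eq/(dense_orthogonal hilbertH dD) => h h_fin.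
rewrite re_ipBl [re_ip ip y h]re_ipC.
have := cvgn_re_part (cvgn_ipl hilbertH (y := h) Sz).
have -> : re_part \o (fun n => ip (reconstruction_series ip f (G \o f) y n) h) =
    (fun n => partial_form ip f n (G y) h).
  by apply/funext => n; rewrite -re_ip_reconstruction.
move=> /(cvg_lim (@Rhausdorff R)); rewrite (cvg_lim (@Rhausdorff R) ((GP y).2 _ h_fin)).
by move=> ->; rewrite subrr.
Qed.

End Reconstruction.

Theorem theorem5p4 (R : realType) (k : field_kind)
  (H : completeNormedModType (scalar_field R k))
  (ip : {dot H for conj_of R k})
  (hilbertH : is_hilbert ip)
  (separableH : separable_space H)
  (infdimH : ~ finite_dimensional H)
  (f : nat -> H)
  (lower_f : lower_frame_condition ip f)
  (dense_f : dense (analysis_domain ip f)) :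
  exists2 g : nat -> H, bessel_sequence ip g &
    forall h : H,
      (reconstruction_series ip f g h @ \oo --> h) <->
      cvgn (reconstruction_series ip f g h).
Proof.
have [A A_gt0 lowerA] := lower_f.
have AE : of_real (re_part A) = A by apply/re_partK/ltW.
have a_gt0 : 0 < re_part A by rewrite -(ltr_of_real k) rmorph0 AE.
have coercive h : finite_energy ip f h ->
    re_part A * real_norm h ^+ 2 <= energy ip f h.
  move=> h_fin; have := lowerA h ((analysis_domainP _ _ _).2 h_fin).
  rewrite (cvg_lim _ (finite_energy_cvg h_fin))//.
  by rewrite -[A in A * _ <= _]AE -(@real_normE _ _ H) -rmorphXn/= -rmorphM ler_of_real.
have /choice[G GP] : forall y, exists u, finite_energy ip f u /\
    forall h, finite_energy ip f h ->
      (fun n => partial_form ip f n u h) @ \oo --> re_ip ip h y.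
  by move=> y; have [u] := weak_solution hilbertH a_gt0 coercive y; exists u.
exists (G \o f); first exact: (bessel_weak_inverse hilbertH a_gt0 coercive GP).
move=> y; split=> [/cvgP //|/cvg_ex[z Sz]].
rewrite -[X in _ --> X](reconstruction_limit hilbertH GP _ Sz) //.
have <- : analysis_domain ip f = finite_energy ip f; last by [].
by apply/seteqP; split=> h /analysis_domainP.
Qed.
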